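(* Let $G$ be an almost bipartite non-König-Egerváry graph with the unique odd cycle $C$. Then $\ker(G)=\mathrm{core}(G)$; moreover, if $G$ is connected, then $$\ker(G)=\bigcup_{y\in V(C)}\ker(D_y-y)=\bigcup_{y\in V(C)}\mathrm{core}(D_y-y)=\mathrm{core}(G).$$
   Context: All graphs are finite, undirected, without loops or multiple edges. $N(A)=\bigcup_{v\in A}N(v)$ denotes the (open) neighborhood of a vertex set $A$. $\alpha(G)$ is the maximum size of an independent set, $\mu(G)$ the maximum size of a matching, $n(G)=|V(G)|$. $G$ is a König-Egerváry graph if $\alpha(G)+\mu(G)=n(G)$, and non-König-Egerváry otherwise. A cycle is a closed trail whose only repeated vertices are the first and the last. $G$ is almost bipartite if it has a unique odd cycle, denoted $C$, with vertex set $V(C)$ and edge set $E(C)$. For $y\in V(C)$, $D_y$ is the connected component containing $y$ of the graph $G-E(C)$ (obtained by deleting the edges of $C$); it is bipartite. $D_y-y$ is the graph obtained from $D_y$ by deleting the vertex $y$ (possibly the graph with no vertices, for which $\ker$ and $\mathrm{core}$ are empty). $\mathrm{core}(G)$ is the intersection of all maximum independent sets of $G$. For $X\subseteq V(G)$, $d_G(X)=|X|-|N(X)|$, and $d(G)=\max\{d_G(X):X\subseteq V(G)\}$. A critical independent set of $G$ is an independent set $A$ with $d_G(A)=\max\{d_G(I): I \text{ independent in } G\}$ (this maximum is known to equal $d(G)$). $\ker(G)$ is the intersection of all critical independent sets of $G$ (the empty set is allowed as a critical independent set). *)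

(* Defs.v *)
From HB Require Import structures.
From mathcomp Require Import all_boot all_order all_algebra.

Set Implicit Arguments.
Unset Strict Implicit.
Unset Printing Implicit Defensive.

Import Order.TTheory GRing.Theory Num.Theory.

(* A finite simple graph whose vertices are drawn from an ambient finType:    *)
(* G, its subgraphs and their vertex sets then all live over the same type.   *)
Record sgraph (T : finType) := SGraph {
  verts : {set T};
  adj : rel T;
  adj_sym : symmetric adj;
  adj_irr : irreflexive adj;
  adj_verts : forall x y, adj x y -> x \in verts
}.

Section Graphs.
Variable T : finType.
Implicit Types (G : sgraph T) (A B S : {set T}) (M F : {set {set T}}).
Implicit Types (x y : T) (c : seq T).

Definition edges G : {set {set T}} :=
  [set [set p.1; p.2] | p : T * T & adj G p.1 p.2].

Definition neigh G A : {set T} := \bigcup_(v in A) [set u | adj G v u].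

Definition independent G A : bool :=
  (A \subset verts G) && [forall x in A, forall y in A, ~~ adj G x y].

Definition alpha G : nat := \max_(A : {set T} | independent G A) #|A|.

Definition max_independent G A : bool :=
  independent G A && (#|A| == alpha G).

Definition core G : {set T} := \bigcap_(A : {set T} | max_independent G A) A.

Definition matching G M : bool := (M \subset edges G) && trivIset M.

Definition mu G : nat := \max_(M : {set {set T}} | matching G M) #|M|.

Definition Konig_Egervary G : bool := alpha G + mu G == #|verts G|.

Definition diff G A : int := (#|A|%:Z - #|neigh G A|%:Z)%R.

Definition critical_independent G A : bool :=
  independent G A &&
  [forall B : {set T}, independent G B ==> (diff G B <= diff G A)%R].

Definition ker G : {set T} :=
  \bigcap_(A : {set T} | critical_independent G A) A.

(* A cycle is given by the list of its successive vertices, the first one not *)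
(* being repeated at the end.                                                 *)
Definition is_cycle G c : bool :=
  [&& 2 < size c, uniq c & cycle (adj G) c].

Definition odd_cycle G c : bool := is_cycle G c && odd (size c).

Definition cycle_verts c : {set T} := [set x in c].

Definition cycle_edges c : {set {set T}} := [set [set x; next c x] | x in c].

(* Lists that differ by a rotation or a reversal describe the same cycle, so  *)
(* uniqueness is up to equality of the edge sets.                             *)
Definition unique_odd_cycle G c : Prop :=
  odd_cycle G c /\
  forall c', odd_cycle G c' -> cycle_edges c' = cycle_edges c.

Definition connected G : Prop :=
  forall x y, x \in verts G -> y \in verts G -> connect (adj G) x y.

Definition induced_adj G S : rel T :=
  fun x y => [&& x \in S, y \in S & adj G x y].

Fact induced_adj_sym G S : symmetric (induced_adj G S).
Proof. by move=> x y; rewrite /induced_adj adj_sym andbCA. Qed.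

Fact induced_adj_irr G S : irreflexive (induced_adj G S).
Proof. by move=> x; rewrite /induced_adj adj_irr !andbF. Qed.

Fact induced_adj_verts G S x y : induced_adj G S x y -> x \in verts G :&: S.
Proof. by case/and3P=> xS _ /adj_verts xG; rewrite inE xG. Qed.

Definition induced G S : sgraph T :=
  SGraph (@induced_adj_sym G S) (@induced_adj_irr G S)
         (@induced_adj_verts G S).

Definition del_vertex G y : sgraph T := induced G [set~ y].

Definition del_edges_adj G F : rel T :=
  fun x y => adj G x y && ([set x; y] \notin F).

Fact del_edges_adj_sym G F : symmetric (del_edges_adj G F).
Proof. by move=> x y; rewrite /del_edges_adj adj_sym setUC. Qed.

Fact del_edges_adj_irr G F : irreflexive (del_edges_adj G F).
Proof. by move=> x; rewrite /del_edges_adj adj_irr. Qed.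

Fact del_edges_adj_verts G F x y : del_edges_adj G F x y -> x \in verts G.
Proof. by case/andP=> /adj_verts. Qed.

Definition del_edges G F : sgraph T :=
  SGraph (@del_edges_adj_sym G F) (@del_edges_adj_irr G F)
         (@del_edges_adj_verts G F).

Definition component G y : sgraph T :=
  induced G [set x | connect (adj G) y x].

(* The graph D_y attached to the vertex y of the cycle c. *)
Definition cycle_branch G c y : sgraph T :=
  component (del_edges G (cycle_edges c)) y.

End Graphs.

(* Main.v *)
Require Import Defs.
From mathcomp Require Import all_boot all_order all_algebra.
From mathcomp Require Import zify.

(* Let I be a critical independent set of largest size and W the complement of
   its closed neighbourhood X. Inside W every nonempty independent set has more
   neighbours than elements, so W cannot be bipartite unless it is empty, in
   which case G is Konig-Egervary. Every odd closed walk uses all the edges of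
   C, so deleting one edge of C makes G bipartite; hence W contains C, and
   comparing the two colour classes of W in each component of G - E(C) shows
   that W = V(C). By Hall's theorem N(I) is matched into I. A maximum
   independent set thus consists of |I| vertices of X and (|C| - 1)/2 vertices
   of C, and meets I in a critical set: ker is contained in core. Conversely, if
   v is not in ker, then exchanging along alternating paths from v gives an
   independent set of size |I| avoiding v; since the component of v in G - E(C)
   touches C at most once, it extends by half of C to a maximum independent set.
   Finally ker G = ker G[X], and if G is connected then G[X] is the disjoint
   union of the bipartite graphs D_y - y. *)

Set Implicit Arguments.
Unset Strict Implicit.
Unset Printing Implicit Defensive.

(** * Hall's marriage theorem *)

Section Hall.
Variable T : finType.

(** Induction on the total size of the lists [r x]: as long as some list has two elements, one of
    them can be removed without breaking Hall's condition. Once all lists are singletons, the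
    condition on pairs is injectivity. *)
Lemma Hall (D : {set T}) (r : T -> {set T}) :
    (forall X : {set T}, X \subset D -> #|X| <= #|\bigcup_(x in X) r x|) ->
  exists f : T -> T, {in D &, injective f} /\ {in D, forall x, f x \in r x}.
Proof.
have [n] := ubnP (\sum_(x in D) #|r x|); elim: n r => // n IHn r ltn hall.
have [/exists_inP[x xD /card_gt1P[a [b [ar br nab]]]]|small] :=
    boolP [exists x in D, 1 < #|r x|].
  pose r' d z := if z == x then r x :\ d else r z.
  have r'E d (X : {set T}) : x \in X ->
      \bigcup_(z in X) r' d z = \bigcup_(z in X :\ x) r z :|: (r x :\ d).
    move=> xX; rewrite (big_setD1 x) //= /r' eqxx setUC; congr (_ :|: _).
    by apply: eq_bigr => z /setD1P[/negPf->].
  have shrink d : d \in r x ->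
      (exists f : T -> T, {in D &, injective f} /\ {in D, forall x, f x \in r x})
      \/ exists X : {set T}, [/\ X \subset D, x \notin X &
           #|\bigcup_(z in X) r z :|: (r x :\ d)| <= #|X|].
    move=> dr; have [/forallP ok|] := boolP [forall X : {set T},
        (X \subset D) ==> (#|X| <= #|\bigcup_(z in X) r' d z|)].
      left; have [||f [finj fr]] := IHn (r' d); last 1 first.
      - exists f; split=> // z /fr; rewrite /r'; case: eqP => // ->.
        by case/setD1P.
      - rewrite ltnS in ltn; apply: leq_trans ltn; rewrite (bigD1 x) //=.
        rewrite [ltnRHS](bigD1 x) //=.
        rewrite /r' eqxx [#|r x|](cardsD1 d) dr add1n addSn ltnS leq_add2l.
        by apply: leq_sum => z /andP[_ /negPf->].
      by move=> X XD; apply: (implyP (ok X)).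
    rewrite negb_forall => /existsP[X]; rewrite negb_imply -ltnNge.
    case/andP=> XD ltX; right.
    have xX : x \in X.
      apply: contraLR ltX => xX; rewrite -leqNgt.
      rewrite (eq_bigr r) ?hall // => z zX; rewrite /r'.
      by case: eqP => // zx; rewrite -zx zX in xX.
    exists (X :\ x); split; first exact: subset_trans (subsetDl _ _) XD.
      by rewrite setD11.
    by move: ltX; rewrite r'E // [#|X|](cardsD1 x) xX.
  case: (shrink a ar) => // -[X [XD xX leX]].
  case: (shrink b br) => // -[Y [YD xY leY]].
  set P := _ :|: _ in leX; set Q := _ :|: _ in leY.
  (* If neither [a] nor [b] can be removed, [X] and [Y] witness the failures. Since [a] and [b]
     differ, [P :|: Q] contains all of [r x], and Hall's condition for the union with [x] and for
     the intersection gives |X| + |Y| + 1 <= |P| + |Q|, a contradiction. *)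
  have : #|x |: (X :|: Y)| <= #|P :|: Q|.
    apply: leq_trans (hall _ _) (subset_leq_card _).
      by rewrite !subUset sub1set xD XD.
    apply/bigcupsP => z; rewrite !inE => /or3P[/eqP->|zX|zY].
    - apply/subsetP => t tr; rewrite !inE tr !andbT.
      by case: (eqVneq t a) => [->|]; rewrite ?nab !orbT.
    - by rewrite (subset_trans (bigcup_sup z zX)) // -setUA subsetUl.
    - rewrite (subset_trans (bigcup_sup z zY)) // setUC -setUA subsetUl //.
  have : #|X :&: Y| <= #|P :&: Q|.
    apply: leq_trans (hall _ _) (subset_leq_card _).
      exact: subset_trans (subsetIl _ _) XD.
    apply/bigcupsP => z /setIP[zX zY]; rewrite subsetI.
    by rewrite !(subset_trans (bigcup_sup z _) (subsetUl _ _)).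
  have := cardsUI X Y; have := cardsUI P Q.
  rewrite cardsU1 !inE negb_or xX xY /=; lia.
have r1 x : x \in D -> exists t, r x = [set t].
  move=> xD; apply/cards1P; rewrite eqn_leq leqNgt.
  move: small; rewrite negb_exists_in => /forall_inP/(_ x xD)-> /=.
  by have := hall [set x]; rewrite sub1set cards1 big_set1 => ->.
exists (fun x => odflt x [pick t in r x]); split=> [x y xD yD|x xD]; last first.
  by have [t ->] := r1 x xD; case: pickP => // /(_ t); rewrite inE eqxx.
have [t rx] := r1 x xD; have [u ry] := r1 y yD.
case: pickP => [t'|/(_ t)]; rewrite rx inE ?eqxx // => /eqP-> /=.
case: pickP => [u'|/(_ u)]; rewrite ry inE ?eqxx // => /eqP-> /= tu.
apply: contraTeq (hall [set x; y] _) => [nxy|]; last first.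
  by apply/subsetP => z /set2P[] ->.
by rewrite -ltnNge cards2 nxy bigcup_setU !big_set1 rx ry tu setUid cards1.
Qed.
End Hall.

(** * Neighbourhoods and critical independent sets *)

Section CriticalSets.
Variable T : finType.
Implicit Types (G : sgraph T) (A B S I K X Z : {set T}) (x y z u v : T).

Lemma neighP G A u :
  reflect (exists2 v, v \in A & adj G v u) (u \in neigh G A).
Proof.
by apply: (iffP bigcupP) => -[v vA]; rewrite ?inE => ?; exists v; rewrite ?inE.
Qed.

Lemma independentP G A :
  reflect (A \subset verts G /\ {in A &, forall x y, ~~ adj G x y})
          (independent G A).
Proof.
apply: (iffP andP) => -[AG indA]; split=> //.
  by move=> x y xA yA; have /forall_inP/(_ x xA)/forall_inP/(_ y yA) := indA.
by apply/forall_inP=> x xA; apply/forall_inP=> y yA; apply: indA.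
Qed.

Lemma independent_sub G A B : A \subset B -> independent G B -> independent G A.
Proof.
move=> AB /independentP[BG indB]; apply/independentP.
split=> [|x y xA yA]; first exact: subset_trans BG.
by apply: indB; apply: (subsetP AB).
Qed.

Lemma independent0 G : independent G set0.
Proof. by apply/independentP; split=> [|x]; rewrite ?sub0set ?inE. Qed.

Lemma neighS G A B : A \subset B -> neigh G A \subset neigh G B.
Proof.
move=> /subsetP AB; apply/subsetP => u /neighP[v /AB vB vu].
by apply/neighP; exists v.
Qed.

Lemma neighU G A B : neigh G (A :|: B) = neigh G A :|: neigh G B.
Proof. exact: bigcup_setU. Qed.

Lemma neigh_verts G A : neigh G A \subset verts G.
Proof.
by apply/subsetP => u /neighP[v _]; rewrite adj_sym => /adj_verts.
Qed.

Lemma independent_neigh G A : independent G A -> [disjoint A & neigh G A].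
Proof.
move=> /independentP[_ indA]; rewrite disjoints_subset; apply/subsetP => u uA.
by rewrite inE; apply/neighP => -[v vA]; apply/negP/indA.
Qed.

Lemma independent_disjoint_neigh G A u :
  independent G A -> u \in neigh G A -> u \notin A.
Proof.
by move=> /independent_neigh; rewrite disjoint_sym => /disjointFr dis /dis ->.
Qed.

Lemma criticalP G A :
  reflect (independent G A /\
           forall B, independent G B -> (diff G B <= diff G A)%R)
          (critical_independent G A).
Proof.
apply: (iffP andP) => -[indA maxA]; split=> //.
  by move=> B indB; apply: (implyP (forallP maxA B)).
by apply/forallP => B; apply/implyP/maxA.
Qed.

(** Removing from [X] its vertices in N(X) leaves an independent set whose neighbours avoid [X], so
    at least as many neighbours as vertices are lost. *)
Lemma diff_le_critical G A X : critical_independent G A ->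
  X \subset verts G -> (diff G X <= diff G A)%R.
Proof.
move=> /criticalP[_ maxA] XG; pose Y := X :\: neigh G X.
have /maxA : independent G Y.
  apply/independentP; split=> [|x y /setDP[xX _] /setDP[_ /neighP yN]].
    exact: subset_trans (subsetDl _ _) XG.
  by apply/negP => xy; apply: yN; exists x.
have : #|neigh G Y| <= #|neigh G X :\: X|.
  apply/subset_leq_card/subsetP => u /neighP[v /setDP[vX /neighP vN] vu].
  rewrite inE; apply/andP; split; last by apply/neighP; exists v.
  by apply/negP => uX; apply: vN; exists u; rewrite // adj_sym.
rewrite /diff; have := cardsID X (neigh G X); have := cardsID (neigh G X) X.
rewrite -/Y setIC; lia.
Qed.

(** The function [diff G] is supermodular. The union of [A] and [B] may fail to be independent, so
    it is bounded by [diff_le_critical]. *)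
Lemma criticalI G A B : critical_independent G A -> critical_independent G B ->
  critical_independent G (A :&: B).
Proof.
move=> critA /criticalP[indB maxB]; have [indA maxA] := criticalP _ _ critA.
have indI : independent G (A :&: B) := independent_sub (subsetIl A B) indA.
apply/criticalP; split=> // S indS; have leS := maxB S indS.
have AB : A :|: B \subset verts G.
  by have [[AG _] [BG _]] := (independentP _ _ indA, independentP _ _ indB);
     rewrite subUset AG.
have := diff_le_critical critA AB.
have : #|neigh G (A :&: B)| <= #|neigh G A :&: neigh G B|.
  by rewrite subset_leq_card // subsetI !neighS ?subsetIl ?subsetIr.
have := cardsUI A B; have := cardsUI (neigh G A) (neigh G B).
by move: leS; rewrite -neighU /diff; lia.
Qed.

Lemma ex_max_critical G : exists2 I, critical_independent G I &
  forall A, critical_independent G A -> #|A| <= #|I|.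
Proof.
have [A0 indA0 maxA0] :
    exists2 A, independent G A &
      forall B, independent G B -> (diff G B <= diff G A)%R.
  case: (Order.TotalTheory.arg_maxP (diff G) (independent0 G)) => A indA maxA.
  by exists A.
have crit0 : critical_independent G A0 by apply/criticalP.
by case: (arg_maxnP (fun A => #|A|) crit0) => I critI maxI; exists I.
Qed.

Lemma kerP G v :
  reflect (forall A, critical_independent G A -> v \in A) (v \in ker G).
Proof. exact: bigcapP. Qed.

Lemma coreP G v :
  reflect (forall A, max_independent G A -> v \in A) (v \in core G).
Proof. exact: bigcapP. Qed.

(* Deleting from a critical set the neighbours of Z frees all of Z from its
   neighbourhood, which is Hall's condition. *)
Lemma critical_hall G I Z : critical_independent G I -> Z \subset neigh G I ->
  #|Z| <= #|I :&: neigh G Z|.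
Proof.
move=> /criticalP[indI maxI] ZN.
have := maxI _ (independent_sub (subsetDl I (neigh G Z)) indI).
have : #|neigh G (I :\: neigh G Z)| <= #|neigh G I :\: Z|.
  apply/subset_leq_card/subsetP => u /neighP[v /setDP[vI /neighP vN] vu].
  rewrite inE; apply/andP; split; last by apply/neighP; exists v.
  by apply/negP => uZ; apply: vN; exists u; rewrite // adj_sym.
rewrite /diff; have := cardsID (neigh G Z) I; have := cardsID Z (neigh G I).
by rewrite (setIidPr ZN); lia.
Qed.

Lemma critical_matching G I : critical_independent G I ->
  exists f : T -> T, {in neigh G I &, injective f} /\
    {in neigh G I, forall z, f z \in I /\ adj G z (f z)}.
Proof.
move=> critI; have [X XN|f [finj fI]] :=
    @Hall T (neigh G I) (fun z => [set u in I | adj G z u]).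
  apply: leq_trans (critical_hall critI XN) (subset_leq_card _).
  apply/subsetP => u /setIP[uI /neighP[v vX vu]].
  by apply/bigcupP; exists v; rewrite // inE uI.
by exists f; split=> // z /fI; rewrite inE => /andP.
Qed.

Lemma connect_invariant (e : rel T) (Q : T -> Prop) x :
  Q x -> (forall y z, Q y -> e y z -> Q z) -> forall y, connect e x y -> Q y.
Proof.
move=> Qx step y /connectP[p].
elim: p x Qx => [|z p IHp] x Qx /= => [_ -> //|].
by case/andP=> /(step _ _ Qx); apply: IHp.
Qed.

(** By [critical_hall], the vertices of [S] in N(I) have at least as many neighbours in [I], and
    none of these is in [S]; hence |S :&: N(I)| <= |I :\: S|. *)
Lemma card_independent_critical G I S : critical_independent G I ->
  independent G S -> #|S :&: (I :|: neigh G I)| <= #|I|.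
Proof.
move=> critI indS; have [indI _] := criticalP _ _ critI.
have := critical_hall critI (subsetIr S (neigh G I)).
have : #|I :&: neigh G (S :&: neigh G I)| <= #|I :\: S|.
  apply/subset_leq_card/subsetP => u /setIP[uI uN]; rewrite inE uI andbT.
  apply: independent_disjoint_neigh indS _.
  by apply: (subsetP _ _ uN); apply/neighS/subsetIl.
have := leq_of_leqif (leq_card_setU (S :&: I) (S :&: neigh G I)).
rewrite -setIUr.
by have := cardsID S I; rewrite [I :&: S]setIC; lia.
Qed.

(** The neighbours of [S :&: I] lie in N(I) and outside [S], so each vertex of [S] in N(I) makes up
    for one vertex of [I] missing from [S]. *)
Lemma critical_capI G I S : critical_independent G I -> independent G S ->
  #|I| <= #|S :&: (I :|: neigh G I)| -> critical_independent G (S :&: I).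
Proof.
move=> /criticalP[indI maxI] indS leI.
apply/criticalP; split=> [|B /maxI].
  exact: independent_sub (subsetIr _ _) indI.
have : #|neigh G (S :&: I)| <= #|neigh G I :\: S|.
  apply/subset_leq_card/subsetP => u uN; rewrite inE.
  rewrite (subsetP (neighS G (subsetIr S I)) _ uN) andbT.
  apply: independent_disjoint_neigh indS _.
  exact: (subsetP (neighS G (subsetIl S I)) _ uN).
have := leq_of_leqif (leq_card_setU (S :&: I) (S :&: neigh G I)).
rewrite -setIUr.
by have := cardsID S (neigh G I); rewrite [_ :&: S]setIC /diff; lia.
Qed.

(* P is the set of vertices of I reachable from v by paths alternating between
   edges of a matching of N(I) into I and other edges; it misses K, so it is
   matched, and it can be traded for its mates Z. *)
Lemma critical_swap G I K (col : T -> bool) v :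
    critical_independent G I -> critical_independent G K -> K \subset I ->
    {in I :|: neigh G I &, forall x y, adj G x y -> col x != col y} ->
    v \in I -> v \notin K ->
  exists S, [/\ independent G S, S \subset I :|: neigh G I, #|S| = #|I|,
    v \notin S &
    {in S :&: neigh G I, forall z,
       connect (induced_adj G (I :|: neigh G I)) v z}].
Proof.
move=> critI critK KI colP vI vK; set X := I :|: neigh G I in colP *.
have [[indI maxI] [indK maxK]] := (criticalP _ _ critI, criticalP _ _ critK).
have [f [finj fP]] := critical_matching critI.
have NKI : neigh G K \subset neigh G I := neighS G KI.
(* The matching sends N(I) minus N(K) injectively into [I :\: K], and criticality of [K] makes the
   source at least as large, so this is a bijection. *)
have mate p : p \in I -> p \notin K ->
    exists z, [/\ z \in neigh G I, z \notin neigh G K & f z = p].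
  move=> pI pK; suff: p \in f @: (neigh G I :\: neigh G K).
    by case/imsetP => z /setDP[zI zK] ->; exists z.
  suff ->: f @: (neigh G I :\: neigh G K) = I :\: K by rewrite inE pK.
  apply/eqP; rewrite eqEcard card_in_imset; last first.
    by move=> x y /setDP[xI _] /setDP[yI _]; apply: finj.
  apply/andP; split.
    apply/subsetP => _ /imsetP[z /setDP[zI /neighP zK] ->].
    have [fzI zfz] := fP z zI; rewrite inE fzI andbT.
    by apply/negP => fzK; apply: zK; exists (f z); rewrite // adj_sym.
  have := maxK I indI; rewrite /diff !cardsD (setIidPr KI) (setIidPr NKI).
  have := subset_leq_card KI; have := subset_leq_card NKI; lia.
(* One alternating move: from [p] along its matching edge to [z], then to any neighbour [q] of [z]
   in [I]. *)
pose e p q := [exists z in neigh G I, [&& f z == p, adj G z q & q \in I]].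
have IX u : u \in I -> u \in X by rewrite inE => ->.
have NX u : u \in neigh G I -> u \in X by rewrite inE orbC => ->.
(* A move never enters [K], because the mate of a vertex outside [K] is not in N(K); having two
   edges inside the bipartite part, it preserves the colour. *)
have inv q : connect e v q ->
    [/\ q \in I, q \notin K, connect (induced_adj G X) v q & col q = col v].
  apply: (@connect_invariant e (fun q => [/\ q \in I, q \notin K,
    connect (induced_adj G X) v q & col q = col v])) => //.
  move=> p {}q [pI pK vp colp] /exists_inP[z zI /and3P[/eqP fz zq qI]].
  have [_ zp] := fP z zI; rewrite fz in zp.
  have [z' [z'I z'K fz']] := mate p pI pK.
  have zz' : z = z' by apply: finj; rewrite // fz fz'.
  split=> //.
  - apply/negP => qK; case/neighP: z'K; exists q => //.
    by rewrite adj_sym -zz'.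
  - apply: connect_trans vp (connect_trans (@connect1 _ _ p z _) (connect1 _)).
      by rewrite /= /induced_adj (IX p) ?(NX z) //= adj_sym.
    by rewrite /= /induced_adj (IX q) ?(NX z).
  - have := colP z q (NX _ zI) (IX _ qI) zq.
    have := colP z p (NX _ zI) (IX _ pI) zp; rewrite colp.
    by case: (col z) (col v) (col q) => [] [] [].
pose P := [set q | connect e v q].
pose Z := [set z in neigh G I | f z \in P].
have ZP z : z \in Z -> [/\ z \in neigh G I, f z \in P & adj G z (f z)].
  by rewrite inE => /andP[zI]; have [_ zfz] := fP z zI.
have vP : v \in P by rewrite inE.
have PI : P \subset I by apply/subsetP => q; rewrite inE => /inv[].
have ZN : Z \subset neigh G I by apply/subsetP => z /ZP[].
have cardZ : #|Z| = #|P|.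
  rewrite -(@card_in_imset _ _ f); last first.
    by move=> x y /ZP[xI _ _] /ZP[yI _ _]; apply: finj.
  congr #|pred_of_set _|; apply/setP => p; apply/imsetP/idP.
    by case=> z /ZP[_ ? _] ->.
  move=> pP; have := pP; rewrite inE => /inv[pI pK _ _].
  have [z [zI _ fz]] := mate p pI pK.
  by exists z; rewrite // inE zI fz.
exists (I :\: P :|: Z); split.
- have IZ x z : x \in I :\: P -> z \in Z -> ~~ adj G z x.
    case/setDP=> xI xP /ZP[zI]; rewrite inE => fzP zfz; apply/negP => zx.
    rewrite inE (connect_trans fzP) // in xP; apply: connect1.
    by apply/exists_inP; exists z; rewrite // eqxx zx.
  have [IG indI'] := independentP _ _ indI.
  apply/independentP; split.
    rewrite subUset (subset_trans (subsetDl _ _) IG) /=.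
    by apply/subsetP => z /ZP[/(subsetP (neigh_verts _ _))].
  move=> x y /setUP[] xS /setUP[] yS.
  + by case/setDP: xS yS => xI _ /setDP[yI _]; apply: indI'.
  + by rewrite adj_sym IZ.
  + exact: IZ.
  (* All of [Z] has the colour opposite to that of [v], so no edge joins two of its vertices. *)
  + have colZ z : z \in Z -> col z != col v.
      move=> /ZP[zI]; rewrite inE => /inv[fI _ _ <-] zfz.
      by apply: colP => //; [apply: NX|apply: IX].
    apply/negP => xy; have [[xI _ _] [yI _ _]] := (ZP _ xS, ZP _ yS).
    have := colP x y (NX _ xI) (NX _ yI) xy.
    have := colZ _ xS; have := colZ _ yS.
    by case: (col x) (col y) (col v) => [] [] [].
- rewrite subUset (subset_trans (subsetDl _ _) (subsetUl _ _)).
  by rewrite (subset_trans ZN) ?subsetUr.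
- have /eqP -> : #|I :\: P :|: Z| == #|I :\: P| + #|Z|.
    rewrite (leq_card_setU _ _).2 disjoints_subset.
    rewrite (subset_trans (subsetDl _ _)) // -disjoints_subset.
    by rewrite (disjointWr ZN) ?independent_neigh.
  by rewrite cardZ cardsD (setIidPr PI) subnK ?subset_leq_card.
- rewrite !inE negb_or negb_and negbK connect0 /= negb_and.
  by apply/orP; left; apply: contraL vI; apply: independent_disjoint_neigh.
- move=> z /setIP[/setUP[/setDP[zI _]|/ZP[zI]]].
    by move=> /(independent_disjoint_neigh indI); rewrite zI.
  rewrite inE => /inv[fI _ vf _] zf _.
  apply: connect_trans vf (connect1 _).
  by rewrite /= /induced_adj IX // NX //= adj_sym.
Qed.

(** * Maximum independent sets and the comparison of kernel and core *)

Lemma max_independentP G A :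
  reflect (independent G A /\ forall B, independent G B -> #|B| <= #|A|)
          (max_independent G A).
Proof.
apply: (iffP andP) => -[indA].
  by move=> /eqP-> ; split=> // B indB; apply: (@leq_bigmax_cond _ (independent G)).
move=> maxA; split=> //; rewrite eqn_leq (@leq_bigmax_cond _ (independent G)) //.
exact/bigmax_leqP.
Qed.

(** Isolates what is needed outside [X]: independent sets have at most [k] vertices there, and for
    each [v] some [B] reaches [k], avoids [v] and can be combined with the set that [critical_swap]
    produces from [v]. Bipartite graphs use it with [k = 0], almost bipartite ones with half of the
    odd cycle. *)
Lemma ker_eq_core G I k (col : T -> bool) :
    let X := I :|: neigh G I in
    critical_independent G I ->
    {in X &, forall x y, adj G x y -> col x != col y} ->
    (forall S, independent G S -> #|S :\: X| <= k) ->
    (forall v, v \in verts G -> exists B, [/\ independent G B,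
      B \subset ~: X, #|B| = k, v \notin B &
      {in neigh G I & B, forall z y,
        connect (induced_adj G X) v z -> ~~ adj G z y}]) ->
  ker G = core G.
Proof.
move=> X critI colP leW exB.
have [indI maxI] := criticalP _ _ critI.
(* No independent set exceeds |I| + k: at most |I| of its vertices are in [X] and at most [k]
   outside. *)
have maxX S B : independent G S -> S \subset X -> #|S| = #|I| ->
    independent G B -> B \subset ~: X -> #|B| = k ->
    {in S & B, forall x y, ~~ adj G x y} -> max_independent G (S :|: B).
  move=> indS SX cardS indB BX cardB SB; apply/max_independentP; split.
    have [[SG indS'] [BG indB']] := (independentP _ _ indS, independentP _ _ indB).
    apply/independentP; split=> [|x y]; first by rewrite subUset SG.
    case/setUP=> xS /setUP[] yS; [exact: indS'|exact: SB| |exact: indB'].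
    by rewrite adj_sym SB.
  move=> A indA; have -> : #|S :|: B| = #|I| + k.
    rewrite -cardS -cardB; apply/eqP; rewrite (leq_card_setU S B).2.
    by rewrite disjoint_sym disjoints_subset (subset_trans BX) ?setCS.
  rewrite -(cardsID X A) leq_add ?leW //.
  exact: card_independent_critical.
have IB B : B \subset ~: X -> {in I & B, forall x y, ~~ adj G x y}.
  move=> /subsetP BX x y xI yB; apply/negP => xy; have := BX y yB.
  rewrite !inE negb_or => /andP[_ /neighP[]]; by exists x.
have IX : I \subset X by rewrite subsetUl.
apply/eqP; rewrite eqEsubset; apply/andP; split; apply/subsetP => v vk.
  have vI : v \in I := kerP _ _ vk I critI.
  have vG : v \in verts G.
    by have [/subsetP IG _] := independentP _ _ indI; apply: IG.
  have [B [indB BX cardB _ _]] := exB v vG.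
  apply/coreP => S /max_independentP[indS maxS].
  suff /(kerP _ _ vk) : critical_independent G (S :&: I) by case/setIP.
  (* A maximum independent set has at least |I| + k vertices, by comparison with [I :|: B], so at
     least |I| of them are in [X]. *)
  apply: critical_capI => //.
  have /max_independentP[indIB _] :=
    maxX _ _ indI IX erefl indB BX cardB (IB B BX).
  have := maxS _ indIB; have := leW _ indS.
  have /eqP -> : #|I :|: B| == #|I| + #|B|.
    rewrite (leq_card_setU I B).2 disjoint_sym disjoints_subset.
    by rewrite (subset_trans BX) ?setCS.
  by rewrite cardB; have := cardsID X S; rewrite -/X; lia.
have vG : v \in verts G.
  have [A indA maxA] : exists2 A, independent G A &
      forall B, independent G B -> #|B| <= #|A|.
    case: (arg_maxnP (fun A => #|A|) (independent0 G)) => A indA maxA.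
    by exists A.
  have [/subsetP AG _] := independentP _ _ indA; apply/AG/(coreP _ _ vk).
  by apply/max_independentP.
have [B [indB BX cardB vB Bcon]] := exB v vG.
have vI : v \in I.
  have := coreP _ _ vk _ (maxX _ _ indI IX erefl indB BX cardB (IB B BX)).
  by rewrite inE (negPf vB) orbF.
apply/kerP => A critA; apply: contraLR isT => vA.
(* The exchange requires a critical set inside [I], hence the intersection with [I]. *)
have critK := criticalI critA critI.
have vK : v \notin A :&: I by rewrite inE negb_and vA.
have [S [indS SX cardS vS conS]] :=
  critical_swap critI critK (subsetIr A I) colP vI vK.
have /(coreP _ _ vk) : max_independent G (S :|: B).
  apply: maxX => // x y xS yB; have /setUP[xI|xN] := subsetP SX x xS.
    exact: IB yB.
  by apply: Bcon (conS _ _) => //; rewrite inE xS.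
by rewrite inE (negPf vS) (negPf vB).
Qed.

(** * Largest critical sets and the König-Egerváry property *)

(** Otherwise [I :|: S] would be a critical set larger than [I]: adding [S] would bring in no more
    new neighbours than new vertices. *)
Lemma max_critical_expands G I S : critical_independent G I ->
    (forall A, critical_independent G A -> #|A| <= #|I|) ->
    independent G S -> S \subset ~: (I :|: neigh G I) -> S != set0 ->
  #|S| < #|neigh G S :\: (I :|: neigh G I)|.
Proof.
move=> critI largestI indS SX; rewrite ltnNge; apply: contra_neqN => leS.
have [indI maxI] := criticalP _ _ critI.
have IS x y : x \in I -> y \in S -> ~~ adj G x y.
  move=> xI yS; apply/negP => xy; have := subsetP SX y yS.
  by rewrite !inE negb_or => /andP[_ /neighP[]]; exists x.
have cardIS : #|I :|: S| = #|I| + #|S|.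
  apply/eqP; rewrite (leq_card_setU I S).2 disjoint_sym disjoints_subset.
  by rewrite (subset_trans SX) // setCS subsetUl.
suff /largestI : critical_independent G (I :|: S).
  by rewrite cardIS -[leqRHS]addn0 leq_add2l leqn0 cards_eq0 => /eqP.
have indIS : independent G (I :|: S).
  have [[IG indI'] [SG indS']] := (independentP _ _ indI, independentP _ _ indS).
  apply/independentP; split=> [|x y]; first by rewrite subUset IG.
  case/setUP=> xS /setUP[] yS; [exact: indI'|exact: IS| |exact: indS'].
  by rewrite adj_sym IS.
apply/criticalP; split=> // B /maxI leB; apply: Order.POrderTheory.le_trans leB _.
have : #|neigh G (I :|: S)| <= #|neigh G I| + #|neigh G S :\: (I :|: neigh G I)|.
  apply: leq_trans (leq_of_leqif (leq_card_setU _ _)).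
  apply/subset_leq_card; rewrite neighU; apply/subsetP => u.
  rewrite !inE; case: (u \in neigh G I) => //= uS; rewrite uS andbT orbF.
  apply/negP => uI; case/neighP: uS => y yS yu.
  by have := IS u y uI yS; rewrite adj_sym yu.
by rewrite /diff cardIS; lia.
Qed.

(** Each colour class of the uncovered part is independent, with its uncovered neighbours in the
    other class. A nonempty class is therefore strictly smaller than the other one, which is then
    nonempty too, and the two inequalities clash. *)
Lemma bipartite_cover G I (col : T -> bool) : critical_independent G I ->
    (forall A, critical_independent G A -> #|A| <= #|I|) ->
    {in verts G :\: (I :|: neigh G I) &, forall x y, adj G x y -> col x != col y} ->
  verts G \subset I :|: neigh G I.
Proof.
move=> critI largestI; set X := I :|: neigh G I => colP.
pose W b := [set x in verts G :\: X | col x == b].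
have WP b x : reflect (x \in verts G :\: X /\ col x = b) (x \in W b).
  by rewrite [x \in W b]in_set; apply: (iffP andP) => -[? /eqP].
have expand b : W b != set0 -> #|W b| < #|W (~~ b)|.
  move=> W0; apply: leq_trans (max_critical_expands critI largestI _ _ W0) _.
  - apply/independentP; split=> [|x y /WP[xW xb] /WP[yW yb]].
      by apply/subsetP => x /WP[/setDP[]].
    by apply/negP => /(colP x y xW yW); rewrite xb yb eqxx.
  - by apply/subsetP => x /WP[/setDP[_ xX] _]; rewrite inE.
  apply/subset_leq_card/subsetP => u /setDP[/neighP[v vW vu] uX].
  case/WP: vW => vW <-.
  have uW : u \in verts G :\: X.
    rewrite inE uX (subsetP (neigh_verts G [set v])) //.
    by apply/neighP; exists v; rewrite ?inE.
  apply/WP; split=> //; have := colP v u vW uW vu.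
  by case: (col v) (col u) => [] [].
have W0 b : W b = set0.
  apply/eqP; apply: contraT => Wb; have := expand _ Wb => ltb.
  suff /expand : W (~~ b) != set0 by rewrite negbK; lia.
  by rewrite -card_gt0; lia.
apply/subsetP => x xG; apply: contraT => xX.
suff : x \in W (col x) by rewrite W0 inE.
by apply/WP; rewrite inE xX.
Qed.

(** Every edge of a matching has an endpoint outside a given independent set, and disjoint edges
    give distinct endpoints. *)
Lemma alpha_mu_le G : alpha G + mu G <= #|verts G|.
Proof.
rewrite /alpha /mu.
have [A indA ->] := eq_bigmax_cond (fun A : {set T} => #|A|)
  (introT card_gt0P (ex_intro _ set0 (independent0 G))).
have mat0 : matching G set0.
  rewrite /matching sub0set; apply/trivIsetP => B C; by rewrite inE.
have [M /andP[ME /trivIsetP dis] ->] :=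
  eq_bigmax_cond (fun M : {set {set T}} => #|M|)
  (introT card_gt0P (ex_intro _ set0 mat0)).
have [AG indA'] := independentP _ _ indA.
have leave e : e \in M -> exists x, x \in e :&: (verts G :\: A).
  move/(subsetP ME) => /imsetP[[x y]]; rewrite inE /= => xy ->.
  have xG := adj_verts xy.
  have yG : y \in verts G by move: xy; rewrite adj_sym => /adj_verts.
  have [xA|xA] := boolP (x \in A); last by exists x; rewrite !inE eqxx xA.
  exists y; rewrite !inE eqxx orbT yG andbT /=.
  by apply: contraL xy; apply: indA'.
have [M0|/set0Pn[e0 /leave[x0 _]]] := eqVneq M set0.
  by rewrite M0 cards0 addn0 subset_leq_card.
(* The default [x0] only makes [g] total; it comes from an edge of [M], which is why the empty
   matching was treated apart. *)
pose g e := odflt x0 [pick x in e :&: (verts G :\: A)].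
have gP e : e \in M -> g e \in e :&: (verts G :\: A).
  by move=> /leave[x xe]; rewrite /g; case: pickP => //= /(_ x); rewrite xe.
have -> : #|M| = #|g @: M|.
  rewrite card_in_imset // => e e' eM e'M gg.
  apply: contraTeq isT => /(dis _ _ eM e'M); rewrite disjoints_subset => /subsetP/(_ (g e)).
  have /setIP[-> _] := gP e eM; move=> /(_ isT); rewrite inE gg.
  by have /setIP[-> _] := gP e' e'M.
rewrite -(cardsID A (verts G)) (setIidPr AG) leq_add2l subset_leq_card //.
by apply/subsetP => _ /imsetP[e /gP/setIP[_ eG] ->].
Qed.

(** The set [I] is independent and the edges from [z] to [f z] form a matching of size |N(I)|, so
    alpha + mu is at least |I| + |N(I)|. *)
Lemma Konig_Egervary_cover G I : critical_independent G I ->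
  verts G \subset I :|: neigh G I -> Konig_Egervary G.
Proof.
move=> critI cover; have [indI _] := criticalP _ _ critI.
have [f [finj fP]] := critical_matching critI.
rewrite /Konig_Egervary eqn_leq alpha_mu_le /=.
apply: leq_trans (subset_leq_card cover) _.
apply: leq_trans (leq_of_leqif (leq_card_setU _ _)) _.
apply: leq_add; first exact: (@leq_bigmax_cond _ (independent G)).
have sep z z' : z \in neigh G I -> z' \in neigh G I -> (z == f z') = false.
  move=> zN z'N; apply: contraTF zN => /eqP->; have [fI _] := fP _ z'N.
  by apply: contraL fI; apply: independent_disjoint_neigh.
have edge_inj : {in neigh G I &, injective (fun z => [set z; f z])}.
  move=> z z' zN z'N /setP/(_ z); rewrite !inE eqxx (sep z z') // orbF.
  by move/esym/eqP.
rewrite -(card_in_imset edge_inj).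
apply: (@leq_bigmax_cond _ (matching G)); apply/andP; split.
  apply/subsetP => _ /imsetP[z zN ->]; apply/imsetP; exists (z, f z) => //.
  by rewrite inE; case: (fP z zN).
apply/trivIsetP => _ _ /imsetP[z zN ->] /imsetP[z' z'N ->] neq.
have nzz : z != z' by apply: contraNneq neq => ->.
rewrite disjoints_subset; apply/subsetP => u /set2P[] ->; rewrite !inE negb_or.
  by rewrite nzz sep.
rewrite eq_sym sep //=; apply: contraNneq nzz => /finj-> //.
Qed.

Lemma ker_core_bipartite G (col : T -> bool) :
  (forall x y, adj G x y -> col x != col y) -> ker G = core G.
Proof.
move=> colP; have [I critI largestI] := ex_max_critical G.
have cover := bipartite_cover critI largestI (in2W colP).
apply: (ker_eq_core (k := 0) critI (in2W colP)) => [S /independentP[SG _]|v vG].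
  by rewrite leqn0 cards_eq0 setD_eq0 (subset_trans SG).
exists set0; rewrite independent0 sub0set cards0 inE; split=> // z y _.
by rewrite inE.
Qed.

(** * Kernels of induced subgraphs *)

(** Graphs with the same vertices and edges may still differ as records in their proof fields, so
    this replaces rewriting by an equality of graphs. *)
Lemma eq_ker G H : verts G = verts H -> adj G =2 adj H -> ker G = ker H.
Proof.
move=> eqV eqE; have eqN A : neigh G A = neigh H A.
  by apply: eq_bigr => v _; apply/setP => u; rewrite !inE eqE.
have eqI A : independent G A = independent H A.
  rewrite /independent eqV; congr (_ && _).
  by do 2!apply: eq_forallb_in => ? _; rewrite eqE.
apply: eq_bigl => A; rewrite /critical_independent eqI; congr (_ && _).
by apply: eq_forallb => B; rewrite eqI /diff !eqN.
Qed.

Lemma independent_induced G X A :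
  independent (induced G X) A = independent G A && (A \subset X).
Proof.
apply/independentP/andP => [[]|[/independentP[AG indA] AX]]; rewrite /= ?subsetI.
  case/andP=> AG AX indA; split=> //; apply/independentP; split=> // x y xA yA.
  by have := indA x y xA yA; rewrite /= /induced_adj !(subsetP AX).
rewrite AG AX; split=> // x y xA yA.
by rewrite /= /induced_adj (negPf (indA x y _ _)) ?andbF.
Qed.

Lemma neigh_induced G X A : A \subset X ->
  neigh (induced G X) A = neigh G A :&: X.
Proof.
move/subsetP=> AX; apply/setP => u; rewrite inE; apply/neighP/andP.
  by case=> v vA /and3P[_ uX vu]; split=> //; apply/neighP; exists v.
by case=> /neighP[v vA vu] uX; exists v; rewrite //= /induced_adj AX ?uX.
Qed.

(** Subsets of [I] have all their neighbours in [X], so their [diff] is the same in both graphs.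
    What remains is to bound the independent sets of the induced graph that meet N(I). *)
Lemma critical_induced_cover G I A : critical_independent G I -> A \subset I ->
  critical_independent (induced G (I :|: neigh G I)) A =
  critical_independent G A.
Proof.
move=> critI AI; set X := I :|: neigh G I; have [indI maxI] := criticalP _ _ critI.
have AX : A \subset X by rewrite (subset_trans AI) ?subsetUl.
have diffA B : B \subset I -> diff (induced G X) B = diff G B.
  move=> BI; rewrite /diff neigh_induced ?(subset_trans BI) ?subsetUl //.
  by rewrite (setIidPl _) // (subset_trans (neighS G BI)) ?subsetUr.
have IX : independent (induced G X) I by rewrite independent_induced indI subsetUl.
apply/criticalP/criticalP; rewrite independent_induced AX andbT => -[indA maxA].
  split=> // B /maxI leB; apply: Order.POrderTheory.le_trans leB _.
  by rewrite -(diffA I) // -(diffA A) //; apply: maxA.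
split=> // B; rewrite independent_induced => /andP[indB BX]; rewrite (diffA A) //.
apply: Order.POrderTheory.le_trans _ (maxA _ indI).
(* Discarding [B :\: I] does not decrease [diff]: by [critical_hall] it has at least |B :\: I|
   neighbours in [I], and these are not neighbours of [B :&: I]. *)
have := maxI _ (independent_sub (subsetIr B I) indI).
have BN : B :\: I \subset neigh G I.
  by apply/subsetP => u /setDP[/(subsetP BX)]; rewrite inE => /orP[->|].
have := critical_hall critI BN.
have : #|neigh G (B :&: I)| + #|I :&: neigh G (B :\: I)| <= #|neigh G B :&: X|.
  have <- : #|neigh G (B :&: I) :|: (I :&: neigh G (B :\: I))| =
            #|neigh G (B :&: I)| + #|I :&: neigh G (B :\: I)|.
    apply/eqP; rewrite (leq_card_setU _ _).2 disjoint_sym.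
    rewrite (disjointWl (subsetIl _ _)) // (disjointWr (neighS G (subsetIr B I))) //.
    exact: independent_neigh.
  apply/subset_leq_card; rewrite subsetI !subUset neighS ?subsetIl //=.
  rewrite (subset_trans (subsetIr _ _)) ?neighS ?subsetDl //=.
  rewrite (subset_trans (neighS G (subsetIr B I))) ?subsetUr //=.
  by rewrite (subset_trans (subsetIl _ _)) ?subsetUl.
by rewrite /diff neigh_induced //; have := cardsID I B; lia.
Qed.

(** By [criticalI], the kernel is already the intersection of the critical sets contained in [I],
    and these are common to both graphs. *)
Lemma ker_induced_cover G I : critical_independent G I ->
  ker (induced G (I :|: neigh G I)) = ker G.
Proof.
move=> critI; have critH := critical_induced_cover critI.
have critHI : critical_independent (induced G (I :|: neigh G I)) I by rewrite critH.
apply/setP => v; apply/kerP/kerP => vk A critA.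
  by have /setIP[] : v \in A :&: I by apply: vk; rewrite critH ?subsetIr ?criticalI.
have /setIP[] // : v \in A :&: I.
by apply: vk; rewrite -critH ?subsetIr ?criticalI.
Qed.

(** No edge leaves [X], so [diff] is additive over [X] and its complement: critical sets restrict to
    [X], and one of the induced graph is completed by the part of a critical set of [G] outside
    [X]. *)
Lemma ker_induced_closed G X : (forall x y, adj G x y -> x \in X -> y \in X) ->
  ker (induced G X) = ker G :&: X.
Proof.
move=> closedX.
have NX A : A \subset X -> neigh G A \subset X.
  move=> /subsetP AX; apply/subsetP => u /neighP[v /AX vX vu]; exact: closedX vX.
have ND A : [disjoint neigh G (A :\: X) & X].
  rewrite disjoints_subset; apply/subsetP => u /neighP[v /setDP[_ vX] vu].
  by rewrite inE; apply: contra vX; apply: closedX; rewrite adj_sym.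
have diffX A : A \subset X -> diff (induced G X) A = diff G A.
  by move=> AX; rewrite /diff neigh_induced // (setIidPl (NX A AX)).
have diffU A B : A \subset X ->
    (diff G (A :|: (B :\: X)) = diff G A + diff G (B :\: X))%R.
  move=> AX; rewrite /diff neighU.
  have /eqP -> : #|A :|: B :\: X| == #|A| + #|B :\: X|.
    rewrite (leq_card_setU _ _).2 disjoint_sym disjoints_subset.
    by apply/subsetP => u /setDP[_ uX]; rewrite inE;
       apply: contra uX; apply: (subsetP AX).
  have /eqP -> : #|neigh G A :|: neigh G (B :\: X)| ==
                 #|neigh G A| + #|neigh G (B :\: X)|.
    by rewrite (leq_card_setU _ _).2 disjoint_sym (disjointWr (NX A AX)).
  lia.
have indU A B : independent (induced G X) A -> independent G B ->
    independent G (A :|: (B :\: X)).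
  rewrite independent_induced => /andP[/independentP[AG indA] /subsetP AX].
  case/independentP=> BG indB; apply/independentP; split.
    by rewrite subUset AG (subset_trans (subsetDl _ _)).
  have sep x y : x \in A -> y \in B :\: X -> ~~ adj G x y.
    by move=> xA /setDP[_ yX]; apply: contra yX => /closedX; apply; apply: AX.
  move=> x y /setUP[] xS /setUP[] yS; [exact: indA|exact: sep| |].
    by rewrite adj_sym sep.
  by case/setDP: xS yS => xB _ /setDP[yB _]; apply: indB.
have splitX A : A = (A :&: X) :|: (A :\: X) by rewrite setID.
apply/setP => v; rewrite inE; apply/idP/andP => [vk|[vk vX]].
  have vX : v \in X.
    have [A critA _] := ex_max_critical (induced G X).
    have [indA _] := criticalP _ _ critA; rewrite independent_induced in indA.
    by case/andP: indA => _ /subsetP; apply; apply: (kerP _ _ vk).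
  split=> //; apply/kerP => A /criticalP[indA maxA].
  suff critAX : critical_independent (induced G X) (A :&: X).
    by have /setIP[] := kerP _ _ vk _ critAX.
  apply/criticalP; split=> [|B indB].
    by rewrite independent_induced subsetIr (independent_sub (subsetIl A X)).
  have BX : B \subset X by move: indB; rewrite independent_induced => /andP[].
  have := maxA _ (indU _ _ indB indA).
  by rewrite {2}[A]splitX !diffU ?subsetIr // !diffX ?subsetIr //; lia.
apply/kerP => B /criticalP[indB maxB].
have [A /criticalP[indA maxA] _] := ex_max_critical G.
have BX : B \subset X by move: indB; rewrite independent_induced => /andP[].
have indAX : independent (induced G X) (A :&: X).
  by rewrite independent_induced subsetIr (independent_sub (subsetIl A X)).
suff critBA : critical_independent G (B :|: (A :\: X)).
  by have := kerP _ _ vk _ critBA; rewrite !inE vX /= orbF.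
apply/criticalP; split=> [|S /maxA leS]; first exact: indU.
apply: Order.POrderTheory.le_trans leS _; rewrite {1}[A]splitX.
have := maxB _ indAX.
by rewrite !diffU ?subsetIr // !diffX ?subsetIr //; lia.
Qed.

End CriticalSets.

(** * Odd closed walks and 2-colourings *)

Section OddCycles.
Variables (T : finType) (r : rel T).
Hypotheses (r_sym : symmetric r) (r_irr : irreflexive r).

Lemma not_uniq_split (p : seq T) : ~~ uniq p ->
  exists q1 x q2 q3, p = q1 ++ x :: q2 ++ x :: q3.
Proof.
elim: p => //= x p IHp; rewrite negb_and negbK => /orP[|/IHp].
  by case/splitPr=> p1 p2; exists [::], x, p1, p2.
by case=> q1 [y [q2 [q3 ->]]]; exists (x :: q1), y, q2, q3.
Qed.

(** A repeated vertex splits the walk into two shorter closed walks, one of which is odd. *)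
Lemma odd_closed_walk p : cycle r p -> odd (size p) ->
  exists c, [/\ 2 < size c, uniq c, cycle r c & odd (size c)].
Proof.
have [n] := ubnP (size p); elim: n p => // n IHn p ltn cycp oddp.
have [Up|/not_uniq_split[q1 [x [q2 [q3 def_p]]]]] := boolP (uniq p).
  exists p; split=> //; case: p cycp oddp {ltn Up} => [|x [|y [|]]] //=.
  by rewrite r_irr.
have : cycle r (x :: q2 ++ x :: q3 ++ q1).
  by move: cycp; rewrite -(rot_cycle (size q1)) def_p rot_size_cat /= -catA.
rewrite /= rcons_cat cat_path /= => /and3P[path2 lastx path3].
move: ltn oddp; rewrite def_p !size_cat /= !size_cat /= => ltn oddp.
have [odd2|even2] := boolP (odd (size q2).+1).
  by apply: (IHn (x :: q2)); rewrite //= ?rcons_path ?path2 //; lia.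
apply: (IHn (x :: q3 ++ q1)); rewrite //= size_cat; lia.
Qed.

(** Works in the bipartite double cover [r2], where a path joining the two lifts of a vertex
    projects to an odd closed walk. The colour of [x] tells whether its lift [(x, true)] is in the
    component of the true lift of the root of [x]. *)
Lemma bipartite_coloring :
    (forall c, 2 < size c -> uniq c -> cycle r c -> ~~ odd (size c)) ->
  exists col : T -> bool, forall x y, r x y -> col x != col y.
Proof.
move=> evenr.
pose r2 (u v : T * bool) := r u.1 v.1 && (v.2 == ~~ u.2).
have r2_sym : symmetric r2.
  by move=> [x a] [y b]; rewrite /r2 /= r_sym; case: a b => [] [].
have walk p u : path r2 u p -> path r u.1 (map fst p) /\
    (last u p).2 = u.2 (+) odd (size p).
  elim: p u => [|v p IHp] u /=; first by rewrite addbF.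
  case/andP=> /andP[-> /eqP v2] /IHp[-> ->]; split=> //.
  by rewrite v2; case: u.2 (odd _) => [] [].
have no_odd x (a : bool) : ~~ connect r2 (x, a) (x, ~~ a).
  apply/connectP => -[p /walk[rp parity] lastp].
  move: parity; rewrite -lastp /= => parity.
  have oddp : odd (size (map fst p)).
    by rewrite size_map; move: parity; case: (a); case: (odd _).
  have [|c [c2 Uc cyc oddc]] := odd_closed_walk (p := map fst p) _ oddp.
    case: (lastP p) rp oddp lastp => // q v; rewrite map_rcons last_rcons.
    by move=> rp _ vx; move: rp; rewrite -vx /= -(rotr_cycle 1) rotr1_rcons.
  by have := evenr c c2 Uc cyc; rewrite oddc.
have r_conn : connect_sym r by apply: sym_connect_sym.
have r2_conn : connect_sym r2 by apply: sym_connect_sym.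
exists (fun x => connect r2 (fingraph.root r x, true) (x, true)) => x y xy.
have -> : fingraph.root r y = fingraph.root r x.
  by apply/esym/fingraph.rootP => //; apply: connect1.
set x0 := fingraph.root r x.
have step (a : bool) : connect r2 (x, a) (y, ~~ a).
  by apply: connect1; rewrite /r2 /= xy eqxx.
have [xt|xf] := boolP (connect r2 (x0, true) (x, true)); have := no_odd y true.
  apply: contraNneq => /esym yt.
  by rewrite r2_conn in yt; apply: connect_trans (connect_trans yt xt) (step _).
apply: contraNneq => /esym yf; case/negP: xf.
(* Some lift of [x] is reached from the base point; it must be [(x, false)], and one more step
   reaches [(y, true)]. *)
have : exists a : bool, connect r2 (x0, true) (x, a).
  have : connect r x0 x by rewrite r_conn connect_root.
  move=> x0x.
  pose Q z := exists a : bool, connect r2 (x0, true) (z, a).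
  apply: (connect_invariant (Q := Q) _ _ x0x).
    by exists true; apply: connect0.
  move=> z z' [a x0z] zz'; exists (~~ a); apply: connect_trans x0z (connect1 _).
  by rewrite /r2 /= zz' eqxx.
case=> -[] // x0x; case/negP: (negbT yf).
exact: connect_trans x0x (step false).
Qed.
End OddCycles.

(** * Successors and edges on a cycle *)

Section CycleNext.
Variables (T : finType) (c : seq T).
Hypothesis Uc : uniq c.

Lemma next_invariant (Q : T -> Prop) y : y \in c -> Q y ->
  (forall x, x \in c -> Q x -> Q (next c x)) -> forall x, x \in c -> Q x.
Proof.
move=> yc Qy step x; rewrite -(fconnect_cycle (cycle_next Uc) yc) => yx.
suff [] : x \in c /\ Q x by [].
apply: (connect_invariant (Q := fun x => x \in c /\ Q x) _ _ yx) => //.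
by move=> u _ [uc Qu] /eqP <-; rewrite mem_next uc; split=> //; apply: step.
Qed.

(** Two distinct vertices with the same edge would be each other's successors, and the cycle would
    close up after two steps. *)
Lemma cycle_edge_inj : 2 < size c ->
  {in c &, injective (fun x => [set x; next c x])}.
Proof.
move=> c2 x y xc yc exy; apply: contraTeq c2 => nxy.
have /set2P[/eqP|xE] : x \in [set y; next c y] by rewrite -exy set21.
  by rewrite (negPf nxy).
have /set2P[/eqP|yE] : y \in [set x; next c x] by rewrite exy set21.
  by rewrite eq_sym (negPf nxy).
rewrite -leqNgt; apply: (@uniq_leq_size _ _ [:: x; y]) => //.
apply: (next_invariant xc); rewrite ?inE ?eqxx // => z _.
by rewrite !inE => /orP[] /eqP ->; rewrite -?xE -?yE eqxx ?orbT.
Qed.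

End CycleNext.

(** * Colourings of a graph with a unique odd cycle *)

Section UniqueOddCycle.
Variables (T : finType) (G : sgraph T) (c : seq T).
Hypothesis hC : unique_odd_cycle G c.
Implicit Types (x y z u v : T) (col : T -> bool).

Let r := del_edges_adj G (cycle_edges c).

Definition edge_coloring x col :=
  forall u v, adj G u v -> [set u; v] != [set x; next c x] -> col u != col v.

Let Uc : uniq c.
Proof. by case: hC => /andP[/and3P[]]. Qed.

Let c_size : 2 < size c.
Proof. by case: hC => /andP[/and3P[]]. Qed.

Let ex_cycle_vertex : exists x, x \in c.
Proof. by move: c_size; case: (c) => // x s _; exists x; apply: mem_head. Qed.

Let c_odd : odd (size c).
Proof. by case: hC => /andP[]. Qed.

Let c_next x : x \in c -> adj G x (next c x).
Proof. by case: hC => /andP[/and3P[_ _ +] _] _; apply: next_cycle. Qed.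

Let neq_edge x y : x \in c -> y \in c -> x != y ->
  [set x; next c x] != [set y; next c y].
Proof. by move=> xc yc; apply: contraNneq => /(cycle_edge_inj Uc c_size)->. Qed.

Let card_cycle : #|[set z in c]| = size c.
Proof. by rewrite cardsE; apply/card_uniqP. Qed.

(* Every odd cycle passes through the edge following x. *)
Lemma ex_edge_coloring x : x \in c -> exists col, edge_coloring x col.
Proof.
move=> xc; pose e := [set x; next c x].
pose r' := del_edges_adj G [set e].
have [|||col colP] := @bipartite_coloring T r'.
- exact: del_edges_adj_sym.
- exact: del_edges_adj_irr.
- move=> c' c'2 Uc' cyc'; apply/negP => odd'.
  have cycG : cycle (adj G) c' by apply: sub_cycle cyc' => u v /andP[].
  have /hC.2 eqE : odd_cycle G c' by rewrite /odd_cycle /is_cycle c'2 Uc' cycG.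
  have : e \in cycle_edges c' by rewrite eqE; apply/imsetP; exists x.
  case/imsetP => z zc' ez; have /andP[_] := next_cycle cyc' zc'.
  by rewrite -ez set11.
exists col => u v uv ne; apply: colP; rewrite /r' /del_edges_adj uv.
by rewrite inE.
Qed.

(** Colours alternate along C except possibly on the edge after [x]. Hence [next] maps the other
    class into that of [x], and the class of [x] minus [x] into the other; as |C| is odd, the class
    of [x] is larger by exactly one. *)
Lemma edge_coloring_card x col : x \in c -> edge_coloring x col ->
  #|[set z in c | col z != col x]| = (size c)./2 /\ col (next c x) = col x.
Proof.
move=> xc colP; have next_inj := can_inj (prev_next Uc).
set B := [set z in c | _]; pose A := [set z in c | col z == col x].
have card_c : #|A| + #|B| = size c.
  rewrite -card_cycle -(cardsID A [set z in c]); congr (_ + _).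
    by apply: eq_card => z; rewrite !inE; case: (z \in c).
  by apply: eq_card => z; rewrite !inE; case: (z \in c); rewrite ?andbT.
have flip z : z \in c -> z != x -> col (next c z) = ~~ col z.
  move=> zc zx; have := colP _ _ (c_next zc) (neq_edge zc xc zx).
  by case: (col z); case: (col (next c z)).
have leBA : #|B| <= #|A|.
  rewrite -(card_imset B next_inj) subset_leq_card //.
  apply/subsetP => _ /imsetP[z + ->]; rewrite !inE mem_next => /andP[zc zx].
  rewrite zc flip //; last by apply: contraNneq zx => ->.
  by case: (col z) (col x) zx => [] [].
have leAB : #|A :\ x| <= #|B|.
  rewrite -(card_imset (A :\ x) next_inj) subset_leq_card //.
  apply/subsetP => _ /imsetP[z + ->]; rewrite !inE mem_next.
  move=> /and3P[nzx zc /eqP zx]; rewrite zc flip // zx.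
  by case: (col x).
have xA : x \in A by rewrite inE xc eqxx.
have := cardsD1 x A; rewrite xA /= => cardA.
have odd_sum : odd (#|A| + #|B|) by rewrite card_c.
split; first by rewrite -card_c; lia.
(* If the edge after [x] also changed colour, [next] would inject the larger class into the
   smaller. *)
apply/eqP; apply: contraT => xnx; suff : #|A| <= #|B| by lia.
rewrite -(card_imset A next_inj) subset_leq_card //.
apply/subsetP => _ /imsetP[z + ->]; rewrite !inE mem_next => /andP[zc /eqP zx].
rewrite zc; have [->|nzx] := eqVneq z x; first exact: xnx.
by rewrite flip // zx; case: (col x).
Qed.

Lemma off_cycle_edge u v : adj G u v -> (u \notin c) || (v \notin c) -> r u v.
Proof.
move=> uv; rewrite /r /del_edges_adj uv /=; apply: contraL => /imsetP[z zc euv].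
have inc w : w \in [set u; v] -> w \in c.
  by rewrite euv => /set2P[] ->; rewrite ?mem_next.
by rewrite negb_or !negbK !inc ?set21 ?set22.
Qed.

(* The sum modulo 2 of colourings missing the two edges of C at y is
   constant on the components of G - E(C) and separates y from the rest of C. *)
Lemma branch_meets_cycle_once y z : y \in c -> z \in c -> connect r y z -> y = z.
Proof.
move=> yc zc yz; have pc : prev c y \in c by rewrite mem_prev.
have npy : next c (prev c y) = y by apply: next_prev.
have [col1 col1P] := ex_edge_coloring pc.
have [col2 col2P] := ex_edge_coloring yc.
have [_ col1p] := edge_coloring_card pc col1P.
have [_ col2y] := edge_coloring_card yc col2P.
pose chi x := col1 x (+) col2 x.
have chiE u v : adj G u v -> [set u; v] != [set prev c y; next c (prev c y)] ->
    [set u; v] != [set y; next c y] -> chi u = chi v.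
  move=> uv /(col1P u v uv) + /(col2P u v uv).
  by rewrite /chi; case: (col1 u) (col1 v) (col2 u) (col2 v) => [] [] [] [].
have : chi z = chi y.
  apply: (connect_invariant (Q := fun x => chi x = chi y) _ _ yz) => //.
  move=> u v <- /andP[uv uvE]; apply/esym/chiE => //; apply: contraNneq uvE => ->.
    by apply/imsetP; exists (prev c y).
  by apply/imsetP; exists y.
(* Walking around C from [y]: on the first edge only [col1] flips, so [chi] changes; it then stays
   constant until the last edge returns to [y]. *)
suff : z = y \/ chi z != chi y by case=> [-> //|/eqP].
apply: (next_invariant Uc (Q := fun x => x = y \/ chi x != chi y) yc) => //.
  by left.
have npny : y != prev c y.
  apply/eqP => py; have := c_next pc; by rewrite npy -py adj_irr.
move=> x xc [->|chix].
  right; have := col1P _ _ (c_next yc) (neq_edge yc pc npny).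
  by rewrite /chi col2y; case: (col1 y); case: (col1 (next c y)); case: (col2 y).
have [->|nxp] := eqVneq x (prev c y); first by left.
have nxy : x != y by apply: contraNneq chix => ->.
by right; rewrite -(chiE x) ?c_next ?neq_edge.
Qed.

Lemma ex_branch_coloring : exists col, forall u v, r u v -> col u != col v.
Proof.
have [x xc] := ex_cycle_vertex.
have [col colP] := ex_edge_coloring xc.
exists col => u v /andP[uv uvE]; apply: colP => //.
by apply: contraNneq uvE => ->; apply/imsetP; exists x.
Qed.

(** The successors of [A] are as many as [A] and lie on C outside [A]. *)
Lemma independent_cycle_card A : independent G A -> A \subset c ->
  #|A| <= (size c)./2.
Proof.
move=> /independentP[_ indA] /subsetP Ac.
have : #|next c @: A| <= #|[set z in c] :\: A|.
  apply/subset_leq_card/subsetP => _ /imsetP[z zA ->].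
  rewrite !inE mem_next Ac // andbT; apply: contraTN (c_next (Ac _ zA)).
  exact: indA.
rewrite (card_imset A (can_inj (prev_next Uc))).
have Ac' : [set z in c] :&: A = A.
  by apply/setIidPr/subsetP => z /Ac; rewrite inE.
have := cardsID A [set z in c]; rewrite Ac' card_cycle; lia.
Qed.

Let r_conn : connect_sym r.
Proof. exact/sym_connect_sym/del_edges_adj_sym. Qed.

(** * The part left uncovered by a largest critical set *)

Section Decomposition.
Variable I : {set T}.
Hypotheses (hKE : ~~ Konig_Egervary G) (critI : critical_independent G I)
  (largestI : forall A, critical_independent G A -> #|A| <= #|I|).

Let X := I :|: neigh G I.

(** If [y] were in [X], no uncovered edge would contain [y], so the colouring that misses the edge
    after [y] would be proper on the uncovered part; [X] would then cover [G]. *)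
Lemma cycle_uncovered y : y \in c -> y \notin X.
Proof.
move=> yc; apply: contra hKE => yX; have [col colP] := ex_edge_coloring yc.
apply: (Konig_Egervary_cover critI).
apply: (bipartite_cover (col := col) critI largestI).
move=> u v /setDP[_ uX] /setDP[_ vX] uv; apply: colP => //.
apply: contraTneq yX => /setP/(_ y); rewrite set21 => /set2P[] -> //.
Qed.

(** Among the uncovered vertices of the component of [x] in G - E(C), [S' b] is a colour class and
    [S b] its part off C. Edges at [S b] are not edges of C, so a nonempty [S b] expands into the
    opposite [S'], although the component has at most one vertex on C. *)
Lemma uncovered_cycle x : x \in verts G -> x \notin X -> x \in c.
Proof.
move=> xG xX; apply: contraT => xc; have [col colP] := ex_branch_coloring.
pose D := [set z in verts G :\: X | connect r x z].
pose S' b := [set z in D | col z == b].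
pose S b := S' b :\: [set z in c].
have S'P b z : reflect [/\ z \in verts G, z \notin X, connect r x z & col z = b]
    (z \in S' b).
  rewrite [_ \in S' b]in_set [_ \in D]in_set in_setD.
  apply: (iffP andP) => [[/andP[/andP[zX zG] xz] /eqP]|[zG zX xz ->]] //.
  by rewrite zG zX xz eqxx.
have SP b z : z \in S b -> z \in S' b /\ z \notin c.
  by move=> /setDP[zS]; rewrite inE.
have expand b : S b != set0 -> #|S b| < #|S' (~~ b)|.
  move=> S0; apply: leq_trans (max_critical_expands critI largestI _ _ S0) _.
  - apply/independentP; split=> [|u v].
      by apply/subsetP => z /SP[/S'P[]].
    move=> /SP[/S'P[_ _ _ ub] uc] /SP[/S'P[_ _ _ vb] _].
    apply/negP => uv; have := colP u v (off_cycle_edge uv _).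
    by rewrite uc ub vb eqxx => /(_ isT).
  - by apply/subsetP => z /SP[/S'P[_ zX _ _] _]; rewrite inE.
  apply/subset_leq_card/subsetP => u.
  case/setDP=> /neighP[v /SP[/S'P[_ _ xv vb] vc] vu] uX.
  have ruv : r v u by apply: off_cycle_edge; rewrite ?vc.
  apply/S'P; split=> //; first by move: vu; rewrite adj_sym => /adj_verts.
    exact: connect_trans xv (connect1 ruv).
  by have := colP v u ruv; rewrite vb; case: (b); case: (col u).
have meet : #|S' true :&: [set z in c]| + #|S' false :&: [set z in c]| <= 1.
  rewrite -cardsUI -setIUl; set Y := _ :&: [set z in c].
  have -> : S' true :&: [set z in c] :&: (S' false :&: [set z in c]) = set0.
    apply/setP => z; rewrite !in_setI in_set0; apply/negP.
    by case/andP=> /andP[/S'P[_ _ _ zt] _] /andP[/S'P[_ _ _]]; rewrite zt.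
  rewrite cards0 addn0; apply/card_le1_eqP.
  have YP z : z \in Y -> z \in c /\ connect r x z.
    by case/setIP=> /setUP[] /S'P[_ _ xz _]; rewrite inE.
  move=> u v /YP[uc xu] /YP[vc xv]; apply: branch_meets_cycle_once => //.
  by apply: connect_trans xu; rewrite r_conn.
have xS : x \in S (col x).
  by rewrite in_setD inE xc; apply/S'P.
have S0 : S (col x) != set0 by apply/set0Pn; exists x.
have := expand _ S0; have : 0 < #|S (col x)| by rewrite card_gt0.
have := cardsID [set z in c] (S' (col x)).
have := cardsID [set z in c] (S' (~~ col x)).
rewrite -/(S (~~ col x)) -/(S (col x)) => cardn cardx posx ltx.
have : #|S' (col x) :&: [set z in c]| + #|S' (~~ col x) :&: [set z in c]| <= 1.
  by move: meet; case: (col x); rewrite // addnC.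
(* If the other class has no vertex off C, expansion puts two vertices of C into it; otherwise the
   two strict inequalities add up to two vertices of C. *)
have := expand (~~ col x); rewrite negbK -card_gt0; lia.
Qed.

(** The set [B] is the smaller colour class of C for a colouring that misses the edge after [y]; it
    avoids [y], the one vertex of C that [v] may reach in G - E(C). *)
Lemma ker_eq_core_almost_bipartite : ker G = core G.
Proof.
have [col colP] := ex_branch_coloring.
have offX x : x \in X -> x \notin c by apply: contraL; apply: cycle_uncovered.
apply: (ker_eq_core (k := (size c)./2) (col := col) critI).
- by move=> u v /offX uc _ uv; apply/colP/off_cycle_edge; rewrite ?uc.
- move=> S indS; apply: independent_cycle_card.
    exact: independent_sub (subsetDl _ _) indS.
  have [/subsetP SG _] := independentP _ _ indS.
  by apply/subsetP => z /setDP[/SG]; apply: uncovered_cycle.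
move=> v vG.
have [y yc vy] : exists2 y, y \in c &
    forall z, z \in c -> connect r v z -> z = y.
  have [/exists_inP[y yc vy]|none] := boolP [exists y in c, connect r v y].
    exists y => // z zc vz; apply: branch_meets_cycle_once => //.
    by apply: connect_trans vy; rewrite r_conn.
  (* When [v] reaches no vertex of C, any [y] will do. *)
  have [y yc] := ex_cycle_vertex.
  exists y => // z zc vz; case/exists_inP: none; by exists z.
have [cole coleP] := ex_edge_coloring yc.
have [cardB _] := edge_coloring_card yc coleP.
set B := [set z in c | _] in cardB.
have BP z : z \in B -> z \in c /\ cole z = ~~ cole y.
  rewrite inE => /andP[zc zy]; split=> //.
  by move: zy; case: (cole z); case: (cole y).
have yB z : z \in B -> z != y.
  by move=> /BP[_]; apply: contra_eqN => /eqP->; case: (cole y).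
exists B; split=> //.
- apply/independentP; split=> [|u w uB wB].
    by apply/subsetP => z /BP[/c_next/adj_verts].
  have [[_ uy] [_ wy]] := (BP _ uB, BP _ wB).
  apply/negP => uw; suff : cole u != cole w by rewrite uy wy eqxx.
  apply: coleP => //; apply/eqP => /setP/(_ y).
  by rewrite set21 !inE eq_sym (negPf (yB _ uB)) eq_sym (negPf (yB _ wB)).
- by apply/subsetP => z /BP[zc _]; rewrite inE; apply: cycle_uncovered.
- apply/negP => vB; have [vc _] := BP _ vB.
  by have := yB _ vB; rewrite (vy v) ?eqxx.
(* An edge from [z] to [w] would connect [v] to [w] in G - E(C), forcing [w = y]. *)
move=> z w zN wB vz; have [wc _] := BP _ wB; apply/negP => zw.
have := yB _ wB; rewrite (vy w) ?eqxx //.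
have zX : z \in X by rewrite inE zN orbT.
apply: connect_trans (connect1 (off_cycle_edge zw _)); last by rewrite offX.
apply: connect_sub vz => u u' /and3P[/offX uc _ uu'].
by apply/connect1/off_cycle_edge; rewrite ?uc.
Qed.

Definition branch_vertices y : {set T} := [set z | connect r y z] :\ y.

Lemma in_branch y z : (z \in branch_vertices y) = (z != y) && connect r y z.
Proof. by rewrite in_setD1 in_set. Qed.

(** The graph D_y - y is a union of components of G[X]: its vertices are covered because D_y meets C
    only in [y], and edges inside [X] avoid C. *)
Lemma ker_branch y : y \in c ->
  ker (del_vertex (cycle_branch G c y) y) = ker G :&: branch_vertices y.
Proof.
move=> yc; rewrite -(ker_induced_cover critI) -/X.
have branchX z : z \in verts G -> z \in branch_vertices y -> z \in X.
  move=> zG; rewrite in_branch => /andP[zy yz]; apply: contraNT zy => zX.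
  have zc := uncovered_cycle zG zX.
  by rewrite (branch_meets_cycle_once yc zc yz).
rewrite -ker_induced_closed; last first.
  move=> u v /and3P[uX vX uv]; rewrite !in_branch => /andP[_ yu].
  apply/andP; split.
    by apply: contraTneq vX => ->; apply: cycle_uncovered.
  apply: connect_trans yu (connect1 (off_cycle_edge uv _)).
  by apply/orP; left; apply: contraL uX; apply: cycle_uncovered.
apply: eq_ker => [|u v].
  apply/setP => z; have := branchX z; rewrite /= !in_setI in_branch !inE -/r.
  case: (z \in verts G); case: (z == y); case: (connect r y z) => //=;
    by rewrite ?andbF ?andbT // => ->.
rewrite /= /induced_adj /= /induced_adj /= /del_edges_adj !in_branch !inE -/r.
apply/and3P/and3P => [[uy vy /and3P[yu yv /andP[uv uvE]]]|].
  have vu : adj G v u by rewrite adj_sym.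
  rewrite uy vy yu yv; split=> //; rewrite uv andbT -!in_setU -/X.
  by rewrite !branchX ?(adj_verts uv) ?(adj_verts vu) // in_branch ?uy ?vy.
case=> /andP[uy yu] /andP[vy yv] /and3P[uX _ uv].
rewrite uy vy yu yv /=; split=> //; apply: off_cycle_edge => //.
by apply/orP; left; apply: contraL uX; rewrite -in_setU; apply: cycle_uncovered.
Qed.

Lemma ker_union_branches : connected G ->
  ker G = \bigcup_(y in cycle_verts c) ker (del_vertex (cycle_branch G c y) y).
Proof.
move=> conG.
have -> : \bigcup_(y in cycle_verts c) ker (del_vertex (cycle_branch G c y) y) =
    \bigcup_(y in cycle_verts c) (ker G :&: branch_vertices y).
  by apply: eq_bigr => y; rewrite inE => /ker_branch.
apply/setP => v; apply/idP/bigcupP => [vk|[y _ /setIP[]]] //.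
have vI := kerP _ _ vk _ critI.
have vX : v \in X by rewrite inE vI.
have vG : v \in verts G.
  by have [/independentP[/subsetP IG _] _] := criticalP _ _ critI; apply: IG.
have [x xc] := ex_cycle_vertex.
have [y yc yv] : exists2 y, y \in c & connect r y v.
  (* Along a path of [G] starting on C, [y] is the last vertex of C met so far. *)
  apply: (connect_invariant (Q := fun v => exists2 y, y \in c & connect r y v) _ _
           (conG x v (adj_verts (c_next xc)) vG)).
    by exists x.
  move=> u w [y yc yu] uw; have [wc|wc] := boolP (w \in c); first by exists w.
  exists y => //; apply: connect_trans yu (connect1 (off_cycle_edge uw _)).
  by rewrite wc orbT.
exists y; rewrite ?in_setI ?in_branch ?inE // vk yv andbT.
by apply: contraTneq vX => ->; apply: cycle_uncovered.
Qed.

End Decomposition.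
End UniqueOddCycle.

Theorem theorem2p10 (T : finType) (G : sgraph T) (c : seq T)
    (hC : unique_odd_cycle G c) (hKE : ~~ Konig_Egervary G) :
  ker G = core G /\
  (connected G ->
    [/\ ker G =
          \bigcup_(y in cycle_verts c) ker (del_vertex (cycle_branch G c y) y),
        \bigcup_(y in cycle_verts c) ker (del_vertex (cycle_branch G c y) y) =
          \bigcup_(y in cycle_verts c) core (del_vertex (cycle_branch G c y) y)
      & \bigcup_(y in cycle_verts c) core (del_vertex (cycle_branch G c y) y) =
          core G]).
Proof.
have [I critI largestI] := ex_max_critical G.
have kerE := ker_eq_core_almost_bipartite hC hKE critI largestI.
split=> // conG; have unionE := ker_union_branches hC hKE critI largestI conG.
have [col colP] := ex_branch_coloring hC.
have eq_union :
    \bigcup_(y in cycle_verts c) ker (del_vertex (cycle_branch G c y) y) =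
    \bigcup_(y in cycle_verts c) core (del_vertex (cycle_branch G c y) y).
  (* Each D_y - y inherits the 2-colouring of G - E(C). *)
  apply: eq_bigr => y _; apply: (ker_core_bipartite (col := col)) => u v.
  by case/and3P=> _ _ /and3P[_ _]; apply: colP.
by split; rewrite -?eq_union -?unionE.
Qed.
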